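(* Let $g:(0,\infty)\to(0,\infty)$ be a function that converges monotonically to zero. If there exists $\epsilon>0$ such that for all $n$ large enough $$\frac{\Lambda_g(n)}{\log\log n}\ \ge\ 2+\epsilon,$$ then $\mathbb P$-almost surely, for all $n$ large enough, $\lambda_1^{(n)}\le 2d\,g(n)$.
   Context: Let $d\ge 2$. Let $\mathfrak E_d=\{\{x,y\}: x,y\in\mathbb Z^d,\ |x-y|_1=1\}$ be the nearest-neighbour edges of $\mathbb Z^d$; write $x\sim y$ if $\{x,y\}\in\mathfrak E_d$. The environment $\boldsymbol w=(w_e)_{e\in\mathfrak E_d}$ (conductances; $w_{xy}=w_{yx}=w_{\{x,y\}}$) is a family of i.i.d. $(0,\infty)$-valued random variables with law $\mathbb P$; $w$ denotes a generic copy. Let $B_n=[-n,n]^d\cap\mathbb Z^d$. For $f\in\ell^2(\mathbb Z^d)$ real-valued, $(\mathcal L_{\boldsymbol w}f)(x)=\sum_{y\sim x}w_{xy}(f(y)-f(x))$ and $\mathcal E^{\boldsymbol w}(f)=\langle f,-\mathcal L_{\boldsymbol w}f\rangle=\frac12\sum_{x}\sum_{y\sim x}w_{xy}(f(x)-f(y))^2$. The principal Dirichlet eigenvalue in $B_n$ is $\lambda_1^{(n)}=\inf\{\mathcal E^{\boldsymbol w}(f): f\in\ell^2(\mathbb Z^d),\ \mathrm{supp}\,f\subseteq B_n,\ \|f\|_2=1\}$. For $g:(0,\infty)\to(0,\infty)$ define $\Lambda_g(u)=u^d\,\mathbb P[w\le g(u)]^{2d}$. *)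

(* Defs.v *)
From HB Require Import structures.
From mathcomp Require Import all_boot all_order all_algebra.
From mathcomp Require Import all_classical all_reals all_analysis.
Set Implicit Arguments. Unset Strict Implicit. Unset Printing Implicit Defensive.
Import Order.TTheory GRing.Theory Num.Theory.
Local Open Scope classical_set_scope.
Local Open Scope ring_scope.

Definition Zd (d : nat) := 'rV[int]_d.

Definition unitv (d : nat) (i : 'I_d) : Zd d := delta_mx 0 i.

(* Nearest-neighbour edges of Z^d are parametrised bijectively by pairs
   (x, i) : Zd d * 'I_d, standing for the edge {x, x + e_i}. *)
Definition edge (d : nat) := (Zd d * 'I_d)%type.

Definition boxidx (d n : nat) := {ffun 'I_d -> 'I_(n.*2.+1)}.
Definition boxpt (d n : nat) (k : boxidx d n) : Zd d :=
  \row_(i < d) ((k i : nat)%:Z - n%:Z).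
Definition in_box (d n : nat) (x : Zd d) : Prop :=
  forall i : 'I_d, (`|x 0 i| <= n%:Z)%R.

(* Dirichlet form E^w(f) = 1/2 sum_x sum_{y ~ x} w_xy (f x - f y)^2, for f
   supported in B_n.  The outer sum is taken over B_{n+1}: every term with
   x outside B_{n+1} vanishes since then f x = f y = 0 for all y ~ x.
   The neighbours of x are x + e_i (edge (x,i)) and x - e_i (edge (x - e_i,i)). *)
Definition dirichlet_form {R : realType} (d n : nat) (w : edge d -> R)
  (f : Zd d -> R) : R :=
  2^-1 * \sum_(k : boxidx d n.+1)
     \sum_(i < d)
       (w (boxpt k, i) * (f (boxpt k) - f (boxpt k + unitv i)) ^+ 2
      + w (boxpt k - unitv i, i) * (f (boxpt k) - f (boxpt k - unitv i)) ^+ 2).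

Definition dirichlet_admissible {R : realType} (d n : nat) (f : Zd d -> R) : Prop :=
  (forall x, ~ in_box n x -> f x = 0) /\
  \sum_(k : boxidx d n) f (boxpt k) ^+ 2 = 1.

Definition lambda1 {R : realType} (d n : nat) (w : edge d -> R) : R :=
  inf [set dirichlet_form n w f | f in [set f : Zd d -> R | dirichlet_admissible n f]].

Definition mutually_independent {R : realType} {dT : measure_display}
  {T : measurableType dT} (P : probability T R) (I : eqType)
  (X : I -> T -> R) : Prop :=
  forall (s : seq I) (B : I -> set R), uniq s ->
    (forall i, measurable (B i)) ->
    P (\bigcap_(i in [set` s]) (X i @^-1` B i)) =
    (\prod_(i <- s) P (X i @^-1` B i))%E.

(* Lambda_g(u) = u^d * P[w <= g(u)]^(2d), with F the common distribution
   function of the conductances. *)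
Definition Lambda {R : realType} (d : nat) (F : R -> R) (g : R -> R) (u : R) : R :=
  u ^+ d * F (g u) ^+ (2 * d).

(* Main.v *)
(* A site x of B_n whose 2d incident conductances are all at most a is a trap:
   its indicator is a test function of energy at most 2da, so the eigenvalue is
   at most 2da.  Traps at sites of one checkerboard colour involve disjoint sets
   of edges, hence are independent, and B_{2^k} contains at least (2^{k+1})^d / 2
   such sites.  So no trap for the level g(2^{k+1}) exists in B_{2^k} with
   probability at most exp (- Lambda_g(2^{k+1}) / 2) <= C (k+1)^{-(1 + eps/2)},
   which is summable; Borel-Cantelli and the monotonicity of g on
   [2^k, 2^{k+1}] conclude. *)
Require Import Defs.
From HB Require Import structures.
From mathcomp Require Import all_boot all_order all_algebra.
From mathcomp Require Import ring lra zify.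
From mathcomp Require Import all_classical all_reals all_analysis.
Set Implicit Arguments. Unset Strict Implicit. Unset Printing Implicit Defensive.
Import Order.TTheory GRing.Theory Num.Theory.
Local Open Scope classical_set_scope.
Local Open Scope ring_scope.

(** * Elementary estimates for exponentials and logarithms *)

Section numeric.
Context {R : realType}.

(** Makes the convergence of the series of (k+1)^(-(1+delta)) explicit by telescoping. With a = ln k
    and b = ln (k+1), the bound ln (1 - 1/(k+1)) <= -1/(k+1) gives exp(-b) <= b - a; after division
    by exp(-delta b), the inequality 1 + y <= exp y at y = delta (b - a) finishes. *)
Lemma riemann_term_le_telescope (delta : R) (k : nat) : 0 < delta -> (0 < k)%N ->
  delta * expR (- ((1 + delta) * ln k.+1%:R)) <=
  expR (- (delta * ln k%:R)) - expR (- (delta * ln k.+1%:R)).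
Proof.
move=> delta0 k0.
have k0R : 0 < k%:R :> R by rewrite ltr0n.
have kS0 : 0 < k.+1%:R :> R by rewrite ltr0n.
set a := ln k%:R; set b := ln k.+1%:R.
have ab : expR (- b) <= b - a.
  have -> : expR (- b) = k.+1%:R^-1 by rewrite expRN lnK// posrE.
  have kE : 1 + - k.+1%:R^-1 = k%:R / k.+1%:R :> R.
    by rewrite -[X in X - _](divff (lt0r_neq0 kS0)) -mulN1r -mulrDl -natr1 addrK.
  have : ln (1 + - k.+1%:R^-1) <= - k.+1%:R^-1 :> R.
    apply: le_ln1Dx; rewrite -subr_gt0 opprK addrC kE.
    by rewrite divr_gt0.
  rewrite kE ln_div ?posrE// -/a -/b => h.
  by rewrite -lerN2 opprB.
have -> : expR (- (delta * a)) = expR (- (delta * b)) * expR (delta * (b - a)).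
  by rewrite -expRD; congr expR; ring.
have -> : expR (- ((1 + delta) * b)) = expR (- (delta * b)) * expR (- b).
  by rewrite -expRD; congr expR; ring.
rewrite mulrCA -[X in _ - X]mulr1 -mulrBr ler_wpM2l ?expR_ge0//.
rewrite lerBrDl (le_trans _ (expR_ge1Dx _))// lerD2l ler_wpM2l// ltW//.
Qed.

Lemma onem_exp_le_expR (p : R) (n : nat) : p <= 1 ->
  (1 - p) ^+ n <= expR (- (p * n%:R)).
Proof.
move=> p1; rewrite -mulNr expRM_natr lerXn2r ?nnegrE ?subr_ge0 ?expR_ge0//.
exact: expR_ge1Dx.
Qed.

Lemma ln2_ge_half : 2^-1 <= ln 2 :> R.
Proof.
rewrite -lerN2 -lnV ?posrE//.
have -> : 2^-1 = 1 + - 2^-1 :> R by field.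
by rewrite (le_trans (le_ln1Dx _))//; lra.
Qed.

Lemma lnln_pow2 (m : nat) : (0 < m)%N ->
  ln (ln (2 ^ m)%:R) = ln m%:R + ln (ln 2) :> R.
Proof.
move=> m0; have ln2_gt0 : 0 < ln 2 :> R by apply: lt_le_trans ln2_ge_half.
by rewrite natrX lnXn// -[ln 2 *+ m]mulr_natl lnM ?posrE ?ltr0n.
Qed.

Lemma lnln_pow2_gt0 (m : nat) : (3 <= m)%N -> 0 < ln (ln (2 ^ m)%:R) :> R.
Proof.
move=> m3; rewrite ln_gt0// natrX lnXn// -[ln 2 *+ m]mulr_natl.
have h := ln2_ge_half.
have m3R : 3 <= m%:R :> R by rewrite (ler_nat _ 3).
(* The threshold m = 3 comes from m ln 2 >= 3/2 > 1. *)
rewrite (@lt_le_trans _ _ (3 * 2^-1))//; first by lra.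
by rewrite ler_pM.
Qed.

End numeric.

(** * Borel-Cantelli and independence of complements *)

Section prob.
Context {R : realType} {dT : measure_display} {T : measurableType dT}.
Variable P : probability T R.

(** Borel-Cantelli with summability supplied by telescoping: the partial sums from [K] on are at
    most [v K - v (K + n)], hence at most [v K]. *)
Lemma ae_eventually_notin (E : nat -> set T) (v : nat -> R) (K : nat) :
  (forall k, measurable (E k)) -> (forall k, 0 <= v k) ->
  (forall k, (K <= k)%N -> (P (E k) <= (v k - v k.+1)%:E)%E) ->
  {ae P, forall t, exists N : nat, forall k, (N <= k)%N -> ~ E k t}.
Proof.
move=> mE v0 PE.
pose E' k := E (K + k)%N.
have mE' k : measurable (E' k) by exact: mE.
exists (lim_sup_set E'); split.
- by apply: bigcap_measurable => // n _; apply: bigcup_measurable => k _.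
- apply: lim_sup_set_cvg0 => //.
  apply: (@le_lt_trans _ _ (v K)%:E); last by rewrite ltry.
  apply: lime_le; first by apply: is_cvg_nneseries => n _ _; exact: measure_ge0.
  apply: nearW => n.
  apply: (@le_trans _ _ (\sum_(0 <= i < n) (v (K + i)%N - v (K + i.+1)%N)%:E)%E).
    apply: lee_sum => i _; rewrite addnS; apply: PE; exact: leq_addr.
  rewrite sumEFin lee_fin.
  have -> : \sum_(0 <= i < n) (v (K + i)%N - v (K + i.+1)%N) =
            - \sum_(0 <= i < n) (v (K + i.+1)%N - v (K + i)%N).
    by rewrite -sumrN; apply: eq_bigr => i _; rewrite opprB.
  rewrite (telescope_sumr (fun i => v (K + i)%N))// opprB addn0.
  by rewrite gerBl.
- move=> t /= nt n _.
  apply: contrapT => nE; apply: nt; exists (K + n)%N => k nk Ek; apply: nE.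
  exists (k - K)%N => /=; first by lia.
  by rewrite /E' subnKC//; lia.
Qed.

Lemma bigcap_cons (I : choiceType) (A : I -> set T) (y : I) (s : seq I) :
  \bigcap_(i in [set` y :: s]) A i = A y `&` \bigcap_(i in [set` s]) A i.
Proof.
by rewrite bigcap_seq big_cons -bigcap_seq.
Qed.

(* Removing the complements one at a time by inclusion-exclusion shows that
   complements of independent events are independent. *)
Lemma prob_bigcap_setC_setI (I : choiceType) (A : I -> set T) (Q : seq I) (p : R) :
  (forall i, measurable (A i)) ->
  (forall s, uniq s -> {subset s <= Q} ->
     P (\bigcap_(i in [set` s]) A i) = (p ^+ size s)%:E) ->
  forall s s', uniq (s ++ s') -> {subset s ++ s' <= Q} ->
  P (\bigcap_(i in [set` s]) ~` A i `&` \bigcap_(i in [set` s']) A i) =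
  ((1 - p) ^+ size s * p ^+ size s')%:E.
Proof.
move=> mA PA; elim=> [|y s ih] s' us sQ.
  rewrite set_nil bigcap_set0 setTI PA// expr0 mul1r//.
have E : \bigcap_(i in [set` y :: s]) ~` A i `&` \bigcap_(i in [set` s']) A i =
  (\bigcap_(i in [set` s]) ~` A i `&` \bigcap_(i in [set` s']) A i) `\` A y.
  by rewrite bigcap_cons setDE -setIA setIC.
have E' : (\bigcap_(i in [set` s]) ~` A i `&` \bigcap_(i in [set` s']) A i) `&` A y =
  \bigcap_(i in [set` s]) ~` A i `&` \bigcap_(i in [set` y :: s']) A i.
  by rewrite bigcap_cons -setIA (setIC (A y)).
have perm : perm_eq (y :: s ++ s') (s ++ y :: s').
  by rewrite perm_sym -cat1s perm_catCA.
have mC : measurable (\bigcap_(i in [set` s]) ~` A i `&` \bigcap_(i in [set` s']) A i).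
  apply: measurableI; apply: fin_bigcap_measurable => // i _.
  exact: measurableC.
have PC := ih s' _ _; have PyC := ih (y :: s') _ _.
rewrite E measureD//; last by rewrite -ge0_fin_numE ?fin_num_measure.
transitivity (((1 - p) ^+ size s * p ^+ size s')%:E -
  ((1 - p) ^+ size s * p ^+ size (y :: s'))%:E)%E; last first.
  by rewrite -EFinB /= !exprS; congr EFin; ring.
congr (_ - _)%E.
- apply: PC; first by move: us => /= /andP[].
  by move=> i si; apply: sQ; rewrite /= inE si orbT.
- rewrite -PyC; first exact: (congr1 P E').
  + by rewrite -(perm_uniq perm).
  + by move=> i; rewrite -(perm_mem perm); exact: sQ.
Qed.

Lemma prob_bigcap_setC (I : choiceType) (A : I -> set T) (s : seq I) (p : R) :
  (forall i, measurable (A i)) -> uniq s ->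
  (forall s', uniq s' -> {subset s' <= s} ->
     P (\bigcap_(i in [set` s']) A i) = (p ^+ size s')%:E) ->
  P (\bigcap_(i in [set` s]) ~` A i) = ((1 - p) ^+ size s)%:E.
Proof.
move=> mA us PA.
have := @prob_bigcap_setC_setI I A s p mA PA s [::].
by rewrite cats0 set_nil bigcap_set0 setIT mulr1; apply.
Qed.

End prob.

(** * Edges incident to a set of sites *)

Section lattice.
Context {d : nat}.
Implicit Types (x y : Zd d) (i : 'I_d).

Definition site_edges x : seq (edge d) :=
  [seq (x, i) | i <- enum 'I_d] ++ [seq (x - unitv i, i) | i <- enum 'I_d].

Lemma size_site_edges x : size (site_edges x) = (2 * d)%N.
Proof. by rewrite size_cat size_map size_enum_ord size_map size_enum_ord mul2n addnn. Qed.

Lemma mem_site_edges x i :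
  (x, i) \in site_edges x /\ (x - unitv i, i) \in site_edges x.
Proof.
by split; rewrite mem_cat; apply/orP; [left|right]; apply: map_f; rewrite mem_enum.
Qed.

Lemma site_edgesP x (e : edge d) :
  e \in site_edges x -> e.1 = x \/ e.1 = x - unitv e.2.
Proof. by rewrite mem_cat => /orP[] /mapP[i _ ->]; [left|right]. Qed.

Definition nonadjacent (s : seq (Zd d)) :=
  forall x y i, x \in s -> y \in s -> x <> y - unitv i.

(** Two distinct sites share an edge only if they are its two endpoints, hence adjacent.
    Disjointness is phrased as [uniq] of one concatenated list because [mutually_independent] takes
    such lists. *)
Lemma uniq_flatten_site_edges (s : seq (Zd d)) : uniq s -> nonadjacent s ->
  uniq (flatten (map site_edges s)).
Proof.
elim: s => //= x s ih /andP[xs us] na.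
rewrite cat_uniq ih//; last by move=> y z i ys zs; apply: na; rewrite inE ?ys ?zs orbT.
rewrite andbT; apply/andP; split.
  rewrite cat_uniq; apply/and3P; split.
  - by rewrite map_inj_uniq ?enum_uniq// => i j [].
  - apply/hasPn => e /mapP[i _ ->]; apply/negP => /mapP[j _ [xE _]].
    by apply: (na x x i); rewrite ?inE ?eqxx.
  - by rewrite map_inj_uniq ?enum_uniq// => i j [].
apply/hasPn => e /flatten_mapP[y ys /site_edgesP ey]; apply/negP => /site_edgesP ex.
have xy : x != y by apply: contraNneq xs => ->.
have [xS yS] : x \in x :: s /\ y \in x :: s by rewrite !inE eqxx ys orbT.
case: ex => ex; case: ey => ey.
- by move/eqP: xy; apply; rewrite -ex -ey.
- by apply: (na x y e.2) => //; rewrite -ex -ey.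
- by apply: (na y x e.2) => //; rewrite -ex -ey.
- by move/eqP: xy; apply; apply: (addIr (- unitv e.2)); rewrite -ex -ey.
Qed.

Lemma sum_unitv i : \sum_j unitv i 0 j = 1.
Proof.
rewrite (bigD1 i)//= mxE !eqxx big1 ?addr0// => j ji.
by rewrite mxE (negbTE ji) andbF.
Qed.

End lattice.

(** * One checkerboard colour of a box *)

Section checkerboard.
Variable d : nat.

(* Half-open box [-n, n)^d: its side is even, so exactly half of its points
   lie on each checkerboard colour. *)
Definition halfbox (n : nat) := {ffun 'I_d -> 'I_n.*2}.

Definition halfbox_pt (n : nat) (k : halfbox n) : Zd d :=
  \row_(i < d) ((k i : nat)%:Z - n%:Z).

Definition checker (n : nat) : {set halfbox n} :=
  [set k : halfbox n | ~~ odd (\sum_i k i)%N]%SET.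

Definition checker_sites (n : nat) : seq (Zd d) :=
  [seq halfbox_pt k | k <- enum (checker n)].

Lemma halfbox_pt_inj n : injective (@halfbox_pt n).
Proof.
move=> k l /rowP kl; apply/ffunP => i; apply/val_inj => /=.
by have := kl i; rewrite !mxE; lia.
Qed.

Lemma uniq_checker_sites n : uniq (checker_sites n).
Proof. by rewrite map_inj_uniq ?enum_uniq//; exact: halfbox_pt_inj. Qed.

Lemma in_box_checker_sites n x : x \in checker_sites n -> in_box n x.
Proof.
by move=> /mapP[k _ ->] i; rewrite mxE ler_norml; case: (k i) => m /= mn; lia.
Qed.

(** A step along [unitv i] changes the coordinate sum by 1, while any two points of one colour have
    coordinate sums of equal parity: the shift by d n is common to both. *)
Lemma nonadjacent_checker_sites n : nonadjacent (checker_sites n).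
Proof.
move=> _ _ i /mapP[k + ->] /mapP[l + ->] kl; rewrite !mem_enum !inE => ek el.
have sumE (h : halfbox n) :
    \sum_j halfbox_pt h 0 j = (\sum_j h j)%N%:Z - \sum_(j < d) n%:Z.
  rewrite (big_morph Posz PoszD (erefl _)) -sumrB.
  by apply: eq_bigr => j _; rewrite mxE.
have : \sum_j halfbox_pt k 0 j = \sum_j halfbox_pt l 0 j - \sum_j unitv i 0 j.
  by rewrite kl -sumrB; apply: eq_bigr => j _; rewrite !mxE.
by rewrite !sumE sum_unitv; lia.
Qed.

Lemma flip_proof n (j : 'I_n.*2) : ((if odd j then j.-1 else j.+1) < n.*2)%N.
Proof. by have := ltn_ord j; case: ifP; lia. Qed.

Definition flip n (j : 'I_n.*2) : 'I_n.*2 := Ordinal (flip_proof j).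

Lemma flipK n : involutive (@flip n).
Proof.
move=> [j jn]; apply/val_inj => /=.
by case: (boolP (odd j)) => h; case: ifP; lia.
Qed.

Definition flip_at n (i : 'I_d) (k : halfbox n) : halfbox n :=
  [ffun j => if j == i then flip (k j) else k j].

Lemma flip_atK n i : involutive (@flip_at n i).
Proof.
by move=> k; apply/ffunP => j; rewrite !ffunE; case: eqP => // _; rewrite flipK.
Qed.

(** Swapping 2m and 2m+1 in one coordinate is an involution of the half-open box that exchanges the
    two colours, so each has half of the (2n)^d points. *)
Lemma size_checker_sites n : (0 < d)%N ->
  (size (checker_sites n) * 2 = n.*2 ^ d)%N.
Proof.
move=> d0; pose i0 := Ordinal d0.
have flipC : (flip_at i0 @^-1: checker n = ~: checker n)%SET.
  apply/setP => k; rewrite !inE; congr (~~ _).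
  rewrite (bigD1 i0)//= [in RHS](bigD1 i0)//= !ffunE eqxx /=.
  rewrite (eq_bigr (fun i => (k i : nat))); last first.
    by move=> i /negbTE ii; rewrite ffunE ii.
  rewrite !oddD -addNb; congr (_ (+) _).
  by case: ifP => h; lia.
rewrite size_map -cardE.
have := cardsC (checker n).
rewrite -flipC (card_preimset _ (inv_inj (@flip_atK n i0))) addnn -muln2 => ->.
by rewrite card_ffun !card_ord.
Qed.

End checkerboard.

(** * Indicator test functions and the eigenvalue *)

Section trap_bound.
Context {R : realType}.
Variable d : nat.
Implicit Types (w : edge d -> R) (x : Zd d).

Lemma boxpt_inj n : injective (@boxpt d n).
Proof.
move=> k l /rowP kl; apply/ffunP => i; apply/val_inj => /=.
by have := kl i; rewrite !mxE; lia.
Qed.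

Lemma boxpt_surj n x : in_box n x -> exists k : boxidx d n, boxpt k = x.
Proof.
move=> xn.
have xn' i : 0 <= x 0 i + n%:Z <= n.*2%:Z.
  by have := xn i; rewrite ler_norml; lia.
have lt i : (`|(x 0 i + n%:Z)%R| < n.*2.+1)%N by have := xn' i; lia.
exists [ffun i => Ordinal (lt i)]; apply/rowP => i; rewrite mxE ffunE /=.
by have := xn' i; lia.
Qed.

(** An inequality, so that no membership of [x] in the box has to be checked: outside it the sum is
    0. *)
Lemma sum_boxpt_eq_le n (h : Zd d -> R) x : (forall y, 0 <= h y) ->
  \sum_(k : boxidx d n) h (boxpt k) * (boxpt k == x)%:R <= h x.
Proof.
move=> h0; have [[k kx]|nk] := pselect (exists k : boxidx d n, boxpt k = x).
  rewrite (bigD1 k)//= kx eqxx mulr1 big1 ?addr0// => l lk.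
  by rewrite -kx (inj_eq (@boxpt_inj n)) (negbTE lk) mulr0.
rewrite big1// => k _; case: eqP => [kx|_]; last by rewrite mulr0.
by case: nk; exists k.
Qed.

Lemma dirichlet_form_ge0 n w f : (forall e, 0 <= w e) -> 0 <= dirichlet_form n w f.
Proof.
move=> w0; rewrite mulr_ge0 ?invr_ge0//; apply: sumr_ge0 => k _.
by apply: sumr_ge0 => i _; rewrite addr_ge0// mulr_ge0// sqr_ge0.
Qed.

Lemma dirichlet_form_delta_le n w (a : R) x : (forall e, 0 <= w e) ->
  (forall e, e \in site_edges x -> w e <= a) ->
  dirichlet_form n w (fun y => (y == x)%:R) <= d.*2%:R * a.
Proof.
move=> w0 wa; rewrite /dirichlet_form exchange_big /= mulr_sumr.
(* Splits each squared difference of indicators into two point masses, each handled by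
   [sum_boxpt_eq_le]. *)
have sq (b c : bool) : (b%:R - c%:R) ^+ 2 <= b%:R + c%:R :> R.
  by case: b c => [] []/=; rewrite ?subrr ?subr0 ?sub0r ?sqrrN ?expr0n ?expr1n ?addr0 ?add0r//=; lra.
suff termle i : 2^-1 * \sum_(k : boxidx d n.+1)
    (w (boxpt k, i) * ((boxpt k == x)%:R - (boxpt k + unitv i == x)%:R) ^+ 2 +
     w (boxpt k - unitv i, i) *
       ((boxpt k == x)%:R - (boxpt k - unitv i == x)%:R) ^+ 2) <= 2 * a.
  apply: (le_trans (ler_sum _ (fun i _ => termle i))).
  rewrite sumr_const card_ord -[leLHS]mulr_natl mulrA -natrM muln2 //.
have [wx wx'] : w (x, i) <= a /\ w (x - unitv i, i) <= a.
  by split; apply: wa; have [] := mem_site_edges x i.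
pose h1 y := w (y, i); pose h2 y := w (y - unitv i, i).
(* Each of the two edges at [x] in direction [i] is seen from both endpoints: four terms at most
   [a], halved by the prefactor. *)
have le4 : \sum_(k : boxidx d n.+1)
    (w (boxpt k, i) * ((boxpt k == x)%:R - (boxpt k + unitv i == x)%:R) ^+ 2 +
     w (boxpt k - unitv i, i) *
       ((boxpt k == x)%:R - (boxpt k - unitv i == x)%:R) ^+ 2) <=
   (h1 x + h1 (x - unitv i)) + (h2 x + h2 (x + unitv i)).
  rewrite big_split/= lerD//.
    apply: le_trans (lerD (@sum_boxpt_eq_le n.+1 h1 x _)
      (@sum_boxpt_eq_le n.+1 h1 (x - unitv i) _)); try by move=> y; exact: w0.
    rewrite -big_split/=; apply: ler_sum => k _; rewrite -mulrDr ler_wpM2l//.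
    by rewrite [_ == x - _]eq_sym subr_eq [x == _]eq_sym; exact: sq.
  apply: le_trans (lerD (@sum_boxpt_eq_le n.+1 h2 x _)
      (@sum_boxpt_eq_le n.+1 h2 (x + unitv i) _)); try by move=> y; exact: w0.
  rewrite -big_split/=; apply: ler_sum => k _; rewrite -mulrDr ler_wpM2l//.
  by rewrite -subr_eq; exact: sq.
move: le4; rewrite /h1 /h2 addrK; set S := \sum_(_ : _) _; lra.
Qed.

Lemma lambda1_le_trap n w (a : R) x : in_box n x -> (forall e, 0 <= w e) ->
  (forall e, e \in site_edges x -> w e <= a) -> lambda1 n w <= d.*2%:R * a.
Proof.
move=> xn w0 wa; apply: le_trans (dirichlet_form_delta_le n w0 wa).
(* The infimum is below a member only for a set bounded below; positivity of the form gives the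
   bound 0. *)
apply: ge_inf; first by exists 0 => _ [f _ <-]; exact: dirichlet_form_ge0.
exists (fun y => (y == x)%:R) => //; split.
  by move=> y yn; case: eqP => // yx; case: yn; rewrite yx.
have [k kx] := boxpt_surj xn.
rewrite (bigD1 k)//= kx eqxx expr1n big1 ?addr0// => l lk.
by rewrite -kx (inj_eq (@boxpt_inj n)) (negbTE lk) expr0n.
Qed.

End trap_bound.

(** * Probability that a box has no trap *)

Section traps.
Context {R : realType} {dT : measure_display} {T : measurableType dT}.
Variables (P : probability T R) (d : nat).
Variables (w : edge d -> {RV P >-> R}) (F : R -> R).
Hypothesis w_indep : mutually_independent P (fun e => (w e : T -> R)).
Hypothesis w_cdf : forall e (u : R), P (w e @^-1` `]-oo, u]) = (F u)%:E.

Definition trap (a : R) (x : Zd d) : set T :=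
  \bigcap_(e in [set` site_edges x]) (w e @^-1` `]-oo, a]).

Lemma trapP a x t : trap a x t <-> forall e, e \in site_edges x -> w e t <= a.
Proof.
by split=> h e /h; rewrite /= in_itv.
Qed.

Lemma measurable_trap a x : measurable (trap a x).
Proof.
apply: fin_bigcap_measurable => // e _.
by rewrite -[X in measurable X]setTI; exact: measurable_funP.
Qed.

Lemma prob_bigcap_trap (a : R) (s : seq (Zd d)) : uniq s -> nonadjacent s ->
  P (\bigcap_(x in [set` s]) trap a x) = ((F a ^+ (2 * d)) ^+ size s)%:E.
Proof.
move=> us na.
have -> : \bigcap_(x in [set` s]) trap a x =
    \bigcap_(e in [set` flatten (map site_edges s)]) (w e @^-1` `]-oo, a]).
  apply/seteqP; split=> t /= h.
    by move=> e /= /flatten_mapP[x xs ex]; exact: (h x xs e ex).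
  by move=> x xs e ex; apply: h => /=; apply/flatten_mapP; exists x.
rewrite (w_indep (B := fun=> `]-oo, a]%classic)) ?uniq_flatten_site_edges//.
under eq_bigr do rewrite w_cdf.
rewrite prodEFin big_const_seq count_predT iter_mulr_1 -exprM; congr (_ ^+ _)%:E.
rewrite size_flatten /shape -map_comp.
under eq_map do rewrite /= size_site_edges.
by rewrite sumnE big_map big_const_seq count_predT iter_addn_0.
Qed.

Lemma prob_no_trap (a : R) (s : seq (Zd d)) : uniq s -> nonadjacent s ->
  P (\bigcap_(x in [set` s]) ~` trap a x) =
  ((1 - F a ^+ (2 * d)) ^+ size s)%:E.
Proof.
move=> us na; apply: prob_bigcap_setC => //; first exact: measurable_trap.
move=> s' us' ss'; apply: prob_bigcap_trap => // x y i xs ys.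
exact: na (ss' _ xs) (ss' _ ys).
Qed.

Lemma cdf_ge0_le1 u : (0 < d)%N -> 0 <= F u <= 1.
Proof.
move=> d0; pose e : edge d := (0, Ordinal d0).
rewrite -!lee_fin -(w_cdf e) measure_ge0/= probability_le1//.
by rewrite -[X in measurable X]setTI; exact: measurable_funP.
Qed.

(** The number of sites is (2n)^d / 2, so its product with the trap probability is exactly half of
    Lambda at 2n. This is why the level is taken at the side length 2n. *)
Lemma prob_no_trap_checker_le (g : R -> R) (n : nat) : (0 < d)%N ->
  (P (\bigcap_(x in [set` checker_sites d n]) ~` trap (g n.*2%:R) x) <=
   (expR (- (Lambda d F g n.*2%:R / 2)))%:E)%E.
Proof.
move=> d0; rewrite prob_no_trap ?uniq_checker_sites//; last first.
  exact: nonadjacent_checker_sites.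
have /andP[F0 F1] := cdf_ge0_le1 (g n.*2%:R) d0.
rewrite lee_fin (le_trans (onem_exp_le_expR _ _))//; first by rewrite exprn_ile1.
rewrite le_eqVlt; apply/orP; left; apply/eqP; congr (expR (- _)).
have := congr1 (fun m => m%:R : R) (size_checker_sites n d0).
rewrite natrM natrX /Lambda => <-.
by field.
Qed.

End traps.

(** * Borel-Cantelli along dyadic scales *)

Theorem theorem1p1 (R : realType) (d : nat) (hd : (2 <= d)%N)
  (dT : measure_display) (T : measurableType dT) (P : probability T R)
  (w : edge d -> {RV P >-> R}) (F : R -> R) (g : R -> R) :
  (* the conductances are i.i.d. and (0,oo)-valued, with distribution function F *)
  mutually_independent P (fun e => (w e : T -> R)) ->
  (forall e t, 0 < w e t) ->
  (forall e (u : R), P (w e @^-1` `]-oo, u]) = (F u)%:E) ->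
  (* g : (0,oo) -> (0,oo) converges monotonically to zero *)
  (forall u, 0 < u -> 0 < g u) ->
  (forall u v, 0 < u -> u <= v -> g v <= g u) ->
  g x @[x --> +oo] --> 0 ->
  (exists eps : R, 0 < eps /\
     exists N : nat, forall n : nat, (N <= n)%N ->
       Lambda d F g n%:R / ln (ln n%:R) >= 2 + eps) ->
  {ae P, forall t, exists N : nat, forall n : nat, (N <= n)%N ->
     lambda1 n (fun e => w e t) <= d.*2%:R * g n%:R}.
Proof.
move=> w_indep w_pos w_cdf g_pos g_mono _ [eps [eps0 [N0 LambdaN0]]].
have d0 : (0 < d)%N by apply: leq_trans hd.
pose E k := \bigcap_(x in [set` checker_sites d (2 ^ k)])
  ~` trap w (g (2 ^ k.+1)%:R) x.
have mE k : measurable (E k).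
  by apply: fin_bigcap_measurable => // x _; apply: measurableC; exact: measurable_trap.
(* Halving [2 + eps] in the exponent leaves [1 + delta]. Since ln ln 2^m = ln m + ln ln 2, the
   constant part of the exponent becomes the factor [C], and [v] is [C / delta] times the
   telescoping sequence. *)
pose delta := eps / 2; have delta0 : 0 < delta by rewrite divr_gt0.
pose C : R := expR (- ((1 + delta) * ln (ln 2))).
pose v k : R := C / delta * expR (- (delta * ln k%:R)).
have v0 k : 0 <= v k by rewrite mulr_ge0 ?expR_ge0// divr_ge0 ?expR_ge0// ltW.
(* The 2 ensures k+1 >= 3, so that ln ln 2^(k+1) is positive and can be cleared from the
   denominator. *)
have PE k : (N0 + 2 <= k)%N -> (P (E k) <= (v k - v k.+1)%:E)%E.
  move=> Nk.
  have kE : (2 ^ k.+1 = (2 ^ k).*2)%N by rewrite expnS mul2n.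
  rewrite /E kE.
  apply: (le_trans (prob_no_trap_checker_le w_indep w_cdf g (2 ^ k) d0)).
  rewrite -kE lee_fin.
  have lnln0 : 0 < ln (ln (2 ^ k.+1)%:R) :> R by apply: lnln_pow2_gt0; lia.
  have := LambdaN0 (2 ^ k.+1)%N.
  rewrite ler_pdivlMr// => /(_ _) hL.
  apply: (@le_trans _ _ (C * expR (- ((1 + delta) * ln k.+1%:R)))).
    rewrite -expRD ler_expR.
    have := hL _; rewrite lnln_pow2// => /(_ _)/= h.
    have {}h : (2 + eps) * (ln k.+1%:R + ln (ln 2)) <= Lambda d F g (2 ^ k.+1)%:R.
      by apply: h; rewrite (leq_trans _ (ltnW (ltn_expl _ _)))//; lia.
    by rewrite /delta; lra.
  rewrite /v -mulrBr -mulrA ler_wpM2l ?expR_ge0//.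
  rewrite ler_pdivlMl//; apply: riemann_term_le_telescope => //; lia.
have := ae_eventually_notin mE v0 PE.
apply: filterS => t [N1 hN1]; exists (2 ^ N1)%N => n Nn.
have n0 : (0 < n)%N by apply: leq_trans Nn; rewrite expn_gt0.
(* With 2^k <= n < 2^(k+1), a trap in the smaller box lies in B_n, and its level g(2^(k+1)) is at
   most g(n). *)
pose k := trunc_log 2 n.
have /andP[kn nk] : (2 ^ k <= n < 2 ^ k.+1)%N by apply: trunc_log_bounds.
have N1k : (N1 <= k)%N by apply: trunc_log_max.
have [x [xs /trapP xt]] : exists x, x \in checker_sites d (2 ^ k) /\
    trap w (g (2 ^ k.+1)%:R) x t.
  apply: contrapT => nx; apply: (hN1 k N1k) => x xs xt; apply: nx.
  by exists x.
apply: (@lambda1_le_trap _ _ _ _ _ x).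
- by move=> i; rewrite (le_trans (in_box_checker_sites xs i))// lez_nat.
- by move=> e; rewrite ltW.
- move=> e /xt we; apply: (le_trans we); apply: g_mono; first by rewrite ltr0n.
  by rewrite ler_nat ltnW.
Qed.
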